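(* Let $m,u\ge 2$, $p\ge 1$ and $n,v\ge 0$ be integers. For integers $N,M,j\ge 0$ let $\mathcal{A}_p(N,M,j)$ denote the set of all $N$-tuples $(a_1,\dots,a_N)$ of positive integer multiples of $p$ with $a_1+\dots+a_N=Mp$ and such that exactly $j$ of the entries $a_s$ are even multiples of $p$ (i.e. of the form $rp$ with $r$ even). Then in $\mathfrak{h}_t^1$ $$ \begin{aligned} z_m z_p^n \overset{t}{\ast} z_u z_p^v ={}&\sum_{l=1}^{n}\ \sum_{k=0}^{\min\{v,n-l\}}\ \sum_{\substack{i+j=k\\ i,j\ge 0}}\ \sum_{(a_1,\dots,a_N)\in\mathcal{A}_p(N,\,n+v-l,\,j)} \binom{v+n-l-2k}{v-k}(t^2-t)^i(1-2t)^j\\ &\quad\times z_m\Big\{z_p^l z_u+(1-2t)z_p^{l-1}z_{u+p}+(1-\delta_{v,0}\delta_{n,l})(t^2-t)z_p^{l-1}x^{u+p}\Big\}\, z_{a_1}\cdots z_{a_N}\\ &+\sum_{l=1}^{v}\ \sum_{k=0}^{\min\{n,v-l\}}\ \sum_{\substack{i+j=k\\ i,j\ge 0}}\ \sum_{(a_1,\dots,a_N)\in\mathcal{A}_p(N,\,n+v-l,\,j)} \binom{v+n-l-2k}{n-k}(t^2-t)^i(1-2t)^j\\ &\quad\times z_u\Big\{z_p^l z_m+(1-2t)z_p^{l-1}z_{m+p}+(1-\delta_{n,0}\delta_{v,l})(t^2-t)z_p^{l-1}x^{m+p}\Big\}\, z_{a_1}\cdots z_{a_N}\\ &+\sum_{k=0}^{\min\{n,v\}}\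 \sum_{\substack{i+j=k\\ i,j\ge 0}}\ \sum_{(a_1,\dots,a_{N'})\in\mathcal{A}_p(N',\,n+v,\,j)} \binom{v+n-2k}{n-k}(t^2-t)^i(1-2t)^j\\ &\quad\times \Big[z_m z_u+z_u z_m+(1-2t)z_{m+u}+(1-\delta_{n,0}\delta_{v,0})(t^2-t)x^{m+u}\Big]\, z_{a_1}\cdots z_{a_{N'}}, \end{aligned} $$ where $N=v+n-l-i-k$ in the first two sums and $N'=v+n-i-k$ in the third.
   Context: Let $A=\{x,y\}$ be two noncommuting letters, $A^*$ the set of all words in $A$ including the empty word $1$, and $\mathfrak{h}_t=\mathbb{Q}[t]\langle A\rangle$ the noncommutative polynomial algebra over $\mathbb{Q}[t]$ generated by $A$ (product = concatenation). Put $\mathfrak{h}_t^1=\mathbb{Q}[t]+\mathfrak{h}_t y$ and, for each positive integer $k$, $z_k=x^{k-1}y$. The t-stuffle product $\overset{t}{\ast}$ on $\mathfrak{h}_t^1$ is the $\mathbb{Q}[t]$-bilinear product determined by: (i) $1\overset{t}{\ast}w=w\overset{t}{\ast}1=w$; (ii) $$z_kw_1\overset{t}{\ast} z_lw_2 = z_k(w_1\overset{t}{\ast} z_lw_2) + z_l(z_kw_1\overset{t}{\ast} w_2)+(1-2t)z_{k+l}(w_1\overset{t}{\ast} w_2)+ [1-\delta(w_1)\delta(w_2)](t^2-t)x^{k+l}(w_1\overset{t}{\ast} w_2)$$ for all words $w,w_1,w_2\in A^*\cap\mathfrak{h}_t^1$ and all positive integers $k,l$, where $\delta(w)=1$ if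 $w=1$ and $\delta(w)=0$ otherwise. $z_p^n$ is the $n$-fold concatenation power, $z_p^0=1$; $\delta_{i,j}$ is Kronecker's delta. Empty sums are $0$; an empty product $z_{a_1}\cdots z_{a_N}$ with $N=0$ is $1$ (and $\mathcal{A}_p(0,0,0)$ consists of the empty tuple, while $\mathcal{A}_p(0,M,j)$ is empty for $(M,j)\neq(0,0)$). *)

(* Defs.v *)
(* Mathematical Components; the free algebra is the monoid algebra (multinomials'
   monalg) of the free monoid of words. *)
From HB Require Import structures.
From mathcomp Require Export all_boot all_order all_algebra.
From mathcomp Require Export finmap.
From mathcomp Require Export monalg.

Set Implicit Arguments.
Unset Strict Implicit.
Unset Printing Implicit Defensive.

Import GRing.Theory.
Local Open Scope ring_scope.

(* [false] is the letter x, [true] the letter y. *)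
Definition word := seq bool.

HB.instance Definition _ := Choice.on word.

Fact cat_eq_nil (v w : word) : v ++ w = [::] -> v = [::] /\ w = [::].
Proof. by case: v. Qed.

HB.instance Definition _ := Choice_isMonomialDef.Build word
  (@catA bool) (@cat0s bool) (@cats0 bool) cat_eq_nil.

Definition ht := {malg {poly rat}[word]}.

Definition t : {poly rat} := 'X.
Definition x : ht := << [:: false] >>.
Definition y : ht := << [:: true] >>.

(* Only meaningful for 0 < k. *)
Definition z (k : nat) : ht := x ^+ k.-1 * y.

Definition ht1 (f : ht) : Prop :=
  exists (c : {poly rat}) (g : ht), f = c%:MP + g * y.

(* The product on the words z_{k_1} ... z_{k_r}, given by their index
   sequences [:: k_1; ...; k_r]. *)
Fixpoint stuffle (a : seq nat) : seq nat -> ht :=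
  match a with
  | [::] => fun b => \prod_(l <- b) z l
  | k :: a' =>
    fix stuffle_a (b : seq nat) : ht :=
      match b with
      | [::] => \prod_(i <- a) z i
      | l :: b' =>
          z k * stuffle a' b + z l * stuffle_a b'
          + (1 - 2%:R * t) *: (z (k + l) * stuffle a' b')
          + ((1 - (nilp a')%:R * (nilp b')%:R) * (t ^+ 2 - t))
              *: (x ^+ (k + l) * stuffle a' b')
      end
  end.

(* The index sequence of x^k w. Trailing x's are dropped, so this is only
   meaningful for words that are empty or end with y. *)
Fixpoint indices (k : nat) (w : seq bool) : seq nat :=
  match w with
  | [::] => [::]
  | false :: w' => indices k.+1 w'
  | true :: w' => k.+1 :: indices 0 w'
  end.

(* Total on ht, but only meaningful on ht1 (see [indices]). *)
Definition tstuffle (f g : ht) : ht :=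
  \sum_(v <- msupp f) \sum_(w <- msupp g)
    (f@_v * g@_w) *: stuffle (indices 0 v) (indices 0 w).

Definition is_tstuffle (star : ht -> ht -> ht) : Prop :=
  [/\ forall f g, ht1 f -> ht1 g -> ht1 (star f g),
      (forall c f f' g, ht1 f -> ht1 f' -> ht1 g ->
         star (c *: f + f') g = c *: star f g + star f' g)
      /\ (forall c f g g', ht1 f -> ht1 g -> ht1 g' ->
            star f (c *: g + g') = c *: star f g + star f g'),
      forall w : word, ht1 << w >> ->
        star 1 << w >> = << w >> /\ star << w >> 1 = << w >>
    & forall (k l : nat) (w1 w2 : word), (0 < k)%N -> (0 < l)%N ->
        ht1 << w1 >> -> ht1 << w2 >> ->
        star (z k * << w1 >>) (z l * << w2 >>) =
          z k * star << w1 >> (z l * << w2 >>)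
          + z l * star (z k * << w1 >>) << w2 >>
          + (1 - 2%:R * t) *: (z (k + l) * star << w1 >> << w2 >>)
          + ((1 - (w1 == [::])%:R * (w2 == [::])%:R) * (t ^+ 2 - t))
              *: (x ^+ (k + l) * star << w1 >> << w2 >>)].

(* As the entries are positive with sum M * p, none of them exceeds M * p: the
   bound built into the type loses nothing (see [tuplesA_complete]). *)
Definition tuplesA (p N M j : nat) : {set N.-tuple 'I_(M * p).+1} :=
  [set a : N.-tuple 'I_(M * p).+1 |
    [&& [forall s, (0 < tnth a s)%N && (p %| tnth a s)%N],
        (\sum_(s < N) tnth a s)%N == (M * p)%N
      & #|[set s | (2 * p %| tnth a s)%N]| == j]].

Definition delta (i j : nat) : {poly rat} := (i == j)%:R.

Lemma tuplesA_complete (p N M j : nat) (a : N.-tuple nat) :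
    (forall s, (0 < tnth a s)%N && (p %| tnth a s)%N) ->
    (\sum_(s < N) tnth a s)%N = (M * p)%N ->
    #|[set s | (2 * p %| tnth a s)%N]| = j ->
  exists2 b, b \in tuplesA p N M j & map val b = a.
Proof.
move=> ha hs hj.
have lt_a s : (tnth a s < (M * p).+1)%N.
  by rewrite ltnS -hs (bigD1 s) //= leq_addr.
exists [tuple inord (tnth a s) | s < N].
  rewrite inE; apply/and3P; split.
  - by apply/forallP => s; rewrite tnth_mktuple inordK ?lt_a ?ha.
  - apply/eqP; rewrite -[RHS]hs; apply: eq_bigr => s _.
    by rewrite tnth_mktuple inordK ?lt_a.
  - rewrite -hj; apply/eqP/eq_card => s.
    by rewrite !inE tnth_mktuple inordK ?lt_a ?ha.
apply: (@eq_from_nth _ 0%N) => [|s]; rewrite size_map !size_tuple // => ltsN.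
rewrite (nth_map ord0) ?size_tuple //.
by rewrite -[s]/(val (Ordinal ltsN)) -!tnth_nth tnth_mktuple /= inordK ?lt_a ?ha.
Qed.

Definition encode (a : seq nat) : word :=
  flatten [seq rcons (nseq k.-1 false) true | k <- a].

Lemma htUM (s1 s2 : word) : (<< s1 >> : ht) * << s2 >> = << s1 ++ s2 >>.
Proof. by rewrite malgM_def fgmulUU mulr1. Qed.

Lemma zE k : z k = << rcons (nseq k.-1 false) true >>.
Proof.
rewrite /z; have -> : x ^+ k.-1 = << nseq k.-1 false >>.
  elim: k.-1 => [|i IH]; first by rewrite expr0.
  by rewrite exprS IH htUM.
by rewrite htUM cats1.
Qed.

Lemma prod_zE (a : seq nat) : \prod_(k <- a) z k = << encode a >>.
Proof.
elim: a => [|k a IH]; first by rewrite big_nil.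
by rewrite big_cons IH zE htUM.
Qed.

Lemma encodeK a : all (ltn 0) a -> indices 0 (encode a) = a.
Proof.
have H i j s : indices i (nseq j false ++ true :: s) = (i + j).+1 :: indices 0 s.
  by elim: j i => [|j IH] i /=; rewrite ?addn0 // IH addSnnS.
elim: a => //= k a IH /andP[k0 /IH ak].
by rewrite /encode /= cat_rcons H ak add0n prednK.
Qed.

Lemma encode_rcons s :
  exists2 a, all (ltn 0) a & rcons s true = encode a.
Proof.
suff H n : exists2 a, all (ltn 0) a & nseq n false ++ rcons s true = encode a.
  exact: (H 0%N).
elim: s n => [|[] s IH] n /=.
- by exists [:: n.+1]; rewrite // /encode /= cats0 cats1.
- have [a a0 e] := IH 0%N; exists (n.+1 :: a) => //=.
  by rewrite /encode /= cat_rcons -/(encode a) -e.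
- have [a a0 e] := IH n.+1; exists a => //; rewrite -e.
  by rewrite -[false :: _]/(nseq 1 false ++ _) catA -nseqD addn1.
Qed.

Lemma ht1_msupp f (w : word) : ht1 f -> w \in msupp f ->
  exists2 a, all (ltn 0) a & w = encode a.
Proof.
move=> [c [g ->]] /(fsubsetP (msuppD_le _ _)); rewrite in_fsetU => /orP[].
  move/(fsubsetP msuppU_le); rewrite in_fset1 => /eqP ->; by exists [::].
move=> /msuppM_le[k1 [k2 [_]]]; rewrite msuppU1 in_fset1 => /eqP -> ->.
have [a a0 e] := encode_rcons k1; exists a => //.
by rewrite -e -cats1.
Qed.

Lemma ht1U (w : word) : ht1 << w >> ->
  exists2 a, all (ltn 0) a & w = encode a.
Proof. by move/ht1_msupp; apply; rewrite msuppU1 in_fset1. Qed.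

Lemma mul_htC (f : ht) c : f * c%:MP = c *: f.
Proof.
rewrite malgM_def fgmulgU malgZ_def.
by apply: eq_bigr => w _; rewrite mulrC mulm1.
Qed.

Lemma htAr c (f g : ht) : f * (c *: g) = c *: (f * g).
Proof. by rewrite -mul_malgC mulrA mul_htC scalerAl. Qed.

Lemma ht1_lin c f g : ht1 f -> ht1 g -> ht1 (c *: f + g).
Proof.
move=> [d [f' ->]] [e [g' ->]]; exists (c * d + e), (c *: f' + g').
rewrite rmorphD rmorphM /= mulrDl scalerDr -scalerAl -mul_malgC.
by rewrite addrACA.
Qed.

Lemma ht10 : ht1 0.
Proof. by exists 0, 0; rewrite raddf0 mul0r addr0. Qed.

Lemma ht1Z c f : ht1 f -> ht1 (c *: f).
Proof. by move=> hf; rewrite -[_ *: _]addr0; apply: ht1_lin ht10. Qed.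

Lemma ht1_hy g : ht1 (g * y).
Proof. by exists 0, g; rewrite raddf0 add0r. Qed.

Lemma hyD f g : (exists h, f = h * y) -> (exists h, g = h * y) ->
  exists h, f + g = h * y.
Proof. by move=> [a ->] [b ->]; exists (a + b); rewrite mulrDl. Qed.

Lemma hyZ c f : (exists h, f = h * y) -> exists h, c *: f = h * y.
Proof. by move=> [a ->]; exists (c *: a); rewrite scalerAl. Qed.

Lemma hyM f g : (exists h, g = h * y) -> exists h, f * g = h * y.
Proof. by move=> [a ->]; exists (f * a); rewrite mulrA. Qed.

Lemma z_ht1 k f : ht1 f -> exists g, z k * f = g * y.
Proof.
move=> [c [g ->]]; rewrite mulrDr; apply: hyD; last first.
  by apply: hyM; exists g.
by rewrite (mul_htC (z k) c); apply: hyZ; exists (x ^+ k.-1).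
Qed.

Lemma ht1_prod_z (a : seq nat) : ht1 (\prod_(k <- a) z k).
Proof.
elim: a => [|k a IH]; last first.
  by rewrite big_cons; have [g ->] := z_ht1 k IH; apply: ht1_hy.
by rewrite big_nil; exists 1, 0; rewrite mul0r addr0 rmorph1.
Qed.

Lemma stuffle_cons k a l b :
  stuffle (k :: a) (l :: b) =
    z k * stuffle a (l :: b) + z l * stuffle (k :: a) b
    + (1 - 2%:R * t) *: (z (k + l) * stuffle a b)
    + ((1 - (nilp a)%:R * (nilp b)%:R) * (t ^+ 2 - t))
        *: (x ^+ (k + l) * stuffle a b).
Proof. by []. Qed.

Lemma stuffle_hy a b : ~~ (nilp a && nilp b) -> exists g, stuffle a b = g * y.
Proof.
suff H a' b' : ht1 (stuffle a' b') /\
    (~~ (nilp a' && nilp b') -> exists g, stuffle a' b' = g * y).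
  exact: (H a b).2.
elim: a' b' => [|k a' IHa] b'.
  split; first exact: ht1_prod_z.
  case: b' => // l b' _ /=; rewrite big_cons; exact/z_ht1/ht1_prod_z.
elim: b' => [|l b' IHb].
  split; first exact: ht1_prod_z.
  by move=> _ /=; rewrite big_cons; exact/z_ht1/ht1_prod_z.
suff [g e] : exists g, stuffle (k :: a') (l :: b') = g * y.
  by split; [rewrite e; apply: ht1_hy | exists g].
rewrite stuffle_cons; apply: hyD; last first.
  have [/andP[-> ->]|/(IHa b').2 H] := boolP (nilp a' && nilp b').
    by rewrite mulr1 subrr mul0r scale0r; exists 0; rewrite mul0r.
  exact/hyZ/hyM.
apply: hyD; last exact/hyZ/z_ht1/(IHa b').1.
by apply: hyD; [exact/z_ht1/(IHa (l :: b')).1 | exact/z_ht1/IHb.1].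
Qed.

Lemma ht1_stuffle a b : ht1 (stuffle a b).
Proof.
have [/andP[]|/stuffle_hy[g ->]] := boolP (nilp a && nilp b).
  by case: a => //; case: b => // _ _; exact: ht1_prod_z.
exact: ht1_hy.
Qed.

Lemma tstuffleEw (d1 d2 : {fset word}) f g :
    (msupp f `<=` d1)%fset -> (msupp g `<=` d2)%fset ->
  tstuffle f g = \sum_(v <- d1) \sum_(w <- d2)
    (f@_v * g@_w) *: stuffle (indices 0 v) (indices 0 w).
Proof.
move=> le1 le2; rewrite /tstuffle (big_fset_incl _ le1) /=.
  apply: eq_bigr => v _; apply: big_fset_incl => // w _ /mcoeff_outdom ->.
  by rewrite mulr0 scale0r.
move=> v _ /mcoeff_outdom ->.
by rewrite big1 // => w _; rewrite mul0r scale0r.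
Qed.

Lemma tstuffle_linl c f f' g :
  tstuffle (c *: f + f') g = c *: tstuffle f g + tstuffle f' g.
Proof.
set d := (msupp f `|` msupp f')%fset.
have le1 : (msupp f `<=` d)%fset by exact: fsubsetUl.
have le2 : (msupp f' `<=` d)%fset by exact: fsubsetUr.
have le3 : (msupp (c *: f + f') `<=` d)%fset.
  by apply: fsubset_trans (msuppD_le _ _) _; apply/fsetSU/msuppZ_le.
rewrite !(@tstuffleEw d (msupp g)) // scaler_sumr -big_split /=.
apply: eq_bigr => v _; rewrite scaler_sumr -big_split /=.
apply: eq_bigr => w _.
by rewrite mcoeffD mcoeffZ mulrDl scalerDl scalerA mulrA.
Qed.

Lemma tstuffle_linr c f g g' :
  tstuffle f (c *: g + g') = c *: tstuffle f g + tstuffle f g'.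
Proof.
set d := (msupp g `|` msupp g')%fset.
have le1 : (msupp g `<=` d)%fset by exact: fsubsetUl.
have le2 : (msupp g' `<=` d)%fset by exact: fsubsetUr.
have le3 : (msupp (c *: g + g') `<=` d)%fset.
  by apply: fsubset_trans (msuppD_le _ _) _; apply/fsetSU/msuppZ_le.
rewrite !(@tstuffleEw (msupp f) d) // scaler_sumr -big_split /=.
apply: eq_bigr => v _; rewrite scaler_sumr -big_split /=.
apply: eq_bigr => w _.
by rewrite mcoeffD mcoeffZ mulrDr scalerDl scalerA mulrCA.
Qed.

Lemma tstuffle_encode (a b : seq nat) : all (ltn 0) a -> all (ltn 0) b ->
  tstuffle << encode a >> << encode b >> = stuffle a b.
Proof.
move=> a0 b0; rewrite /tstuffle !msuppU1 !big_seq_fset1.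
by rewrite !mcoeffUU mulr1 scale1r !encodeK.
Qed.

Lemma encode_cons k a :
  << encode (k :: a) >> = z k * << encode a >>.
Proof. by rewrite zE htUM. Qed.

Lemma ht1_sum (d : seq word) (F : word -> ht) :
  (forall w, ht1 (F w)) -> ht1 (\sum_(w <- d) F w).
Proof.
move=> hF; elim: d => [|w d IH]; first by rewrite big_nil; exact: ht10.
by rewrite big_cons -[F w]scale1r; apply: ht1_lin.
Qed.

Lemma nilp_encode a : (encode a == ([::] : word)) = nilp a.
Proof. by rewrite /encode; case: a => //= k a; case: k.-1. Qed.

Theorem tstuffleP : is_tstuffle tstuffle.
Proof.
split.
- move=> f g _ _; apply: ht1_sum => v; apply: ht1_sum => w.
  exact/ht1Z/ht1_stuffle.
- by split=> *; [apply: tstuffle_linl | apply: tstuffle_linr].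
- move=> w /ht1U[a a0 ->]; have nil0 : all (ltn 0) [::] by [].
  rewrite -[1]/(<< encode [::] >> : ht); split.
    by rewrite (tstuffle_encode nil0 a0) -prod_zE.
  by rewrite (tstuffle_encode a0 nil0) -prod_zE; case: a {a0}.
- move=> k l w1 w2 k0 l0 /ht1U[a a0 ->] /ht1U[b b0 ->].
  have ka0 : all (ltn 0) (k :: a) by rewrite /= k0.
  have lb0 : all (ltn 0) (l :: b) by rewrite /= l0.
  have ka := encode_cons k a; have lb := encode_cons l b.
  rewrite !nilp_encode -ka -lb; transitivity (stuffle (k :: a) (l :: b)).
    exact: tstuffle_encode.
  rewrite stuffle_cons.
  rewrite -(tstuffle_encode a0 lb0) -(tstuffle_encode ka0 b0).
  by rewrite -(tstuffle_encode a0 b0).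
Qed.

Theorem tstuffle_unique star : is_tstuffle star ->
  forall f g, ht1 f -> ht1 g -> star f g = tstuffle f g.
Proof.
case=> _ [linl linr] star1 starz.
have starE a b : all (ltn 0) a -> all (ltn 0) b ->
    star << encode a >> << encode b >> = stuffle a b.
  have hE c : ht1 << encode c >> by rewrite -prod_zE; exact: ht1_prod_z.
  elim: a b => [|k a IHa] b.
    by move=> _ _; rewrite (star1 _ (hE b)).1 /= prod_zE.
  move=> /andP[k0 a0]; elim: b => [|l b IHb].
    by move=> _; rewrite (star1 _ (hE (k :: a))).2 /= prod_zE.
  move=> /andP[l0 b0]; have lb0 : all (ltn 0) (l :: b) by apply/andP.
  have ka := encode_cons k a; have lb := encode_cons l b.
  rewrite ka lb (starz k l _ _ k0 l0 (hE a) (hE b)) -ka -lb !nilp_encode.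
  by rewrite stuffle_cons (IHa _ a0 lb0) (IHb b0) (IHa _ a0 b0).
have starE0 f : ht1 f -> star 0 f = 0.
  move=> hf; have := linl 1 0 0 f ht10 ht10 hf.
  by rewrite !scale1r addr0 -[LHS]addr0 => /addrI.
have starE0r f : ht1 f -> star f 0 = 0.
  move=> hf; have := linr 1 f 0 0 hf ht10 ht10.
  by rewrite !scale1r addr0 -[LHS]addr0 => /addrI.
have decomp f : ht1 f -> exists s : seq ({poly rat} * seq nat),
    all (fun ca => all (ltn 0) ca.2) s /\
    f = \sum_(ca <- s) ca.1 *: << encode ca.2 >>.
  move=> hf; exists [seq (f@_w, indices 0 w) | w <- msupp f]; split.
    apply/allP => _ /mapP[w /(ht1_msupp hf)[a a0 ->] ->] /=.
    by rewrite encodeK.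
  rewrite big_map [LHS]monalgE big_seq [RHS]big_seq; apply: eq_bigr => w.
  move=> /(ht1_msupp hf)[a a0 ->] /=; rewrite encodeK //; apply/malgP => v.
  by rewrite mcoeffZ !mcoeffU mulrnAr mulr1.
have hE c : ht1 << encode c >> by rewrite -prod_zE; exact: ht1_prod_z.
have hS (s : seq ({poly rat} * seq nat)) :
    ht1 (\sum_(ca <- s) ca.1 *: << encode ca.2 >>).
  elim: s => [|ca s IH]; first by rewrite big_nil; exact: ht10.
  by rewrite big_cons; apply: ht1_lin.
have tst0 g : tstuffle 0 g = 0 by rewrite /tstuffle msupp0 big_seq_fset0.
have tst0r f : tstuffle f 0 = 0.
  by rewrite /tstuffle big1 // => w _; rewrite msupp0 big_seq_fset0.
have stepl c f F g : ht1 f -> ht1 F -> ht1 g ->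
    star f g = tstuffle f g -> star F g = tstuffle F g ->
    star (c *: f + F) g = tstuffle (c *: f + F) g.
  by move=> hf hF hg ef eF; rewrite tstuffle_linl -ef -eF; exact: linl.
have stepr c f g G : ht1 f -> ht1 g -> ht1 G ->
    star f g = tstuffle f g -> star f G = tstuffle f G ->
    star f (c *: g + G) = tstuffle f (c *: g + G).
  by move=> hf hg hG eg eG; rewrite tstuffle_linr -eg -eG; exact: linr.
move=> f g /decomp[s [s0 ->]] /decomp[r [r0 ->]].
elim: s s0 => [_|[c a] s IHs /andP[a0 s0]].
  by rewrite big_nil (starE0 _ (hS r)) tst0.
rewrite big_cons; apply: stepl (hE a) (hS s) (hS r) _ (IHs s0).
elim: r r0 {IHs} => [_|[d b] r IHr /andP[b0 r0]].
  by rewrite big_nil (starE0r _ (hE a)) tst0r.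
rewrite big_cons; apply: stepr (hE a) (hE b) (hS r) _ (IHr r0).
by rewrite (starE _ _ a0 b0) (tstuffle_encode a0 b0).
Qed.

(* Main.v *)
Require Import Defs.
From mathcomp Require Import all_boot all_order all_algebra finmap monalg.
From mathcomp Require Import ssrAC zify.

Import GRing.Theory.
Local Open Scope ring_scope.

(** Put c = t^2 - t and d = 1 - 2t. The t-stuffle of z_p^n and z_p^v is the
    coefficient of A^n B^v in the series G determined by
      G = 1 + (A + B) z_p G + A B d z_{2p} G + A B c x^{2p} (G - 1).
    Since x^{2p} z_{rp} = z_{(r+2)p}, a word z_{a_1 p} ... z_{a_N p} occurs in G
    with one factor (A + B) (A B c)^q for each letter a_s = 2q + 1 and one
    factor d A B (A B c)^q for each letter a_s = 2q + 2. If i is the sum of the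
    q's, j the number of even letters and k = i + j, then there are n + v - 2k
    odd letters, and the coefficient of A^n B^v in the product of these factors
    is binomial(n + v - 2k, n - k) c^i d^j.
    The product in the theorem reduces to such products by peeling off letters
    of z_p^n (resp. z_p^v) until the letter z_u (resp. z_m) has been used. *)

(** * Compositions of an integer *)

(** Left multiplication by $x^{2p}$ in terms of letters. The empty word has no first letter to
    shift; sums over this map filter it out, as $G - 1$ demands. *)
Definition bump2 (a : seq nat) : seq nat :=
  if a is r :: a' then r.+2 :: a' else [::].

(* The compositions of M. Splitting them by their first letter 1, 2 or r + 2
   mirrors the three kinds of terms of the t-stuffle recursion. *)
Fixpoint comps (M : nat) : seq (seq nat) :=
  match M with
  | 0 => [:: [::]]
  | M1.+1 =>
    match M1 with
    | 0 => [:: [:: 1%N]]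
    | M2.+1 => [seq 1%N :: a | a <- comps M1] ++
               [seq 2%N :: a | a <- comps M2] ++
               [seq bump2 a | a <- comps M2 & ~~ nilp a]
    end
  end.

Lemma compsSS M : comps M.+2 =
  [seq 1%N :: a | a <- comps M.+1] ++ [seq 2%N :: a | a <- comps M] ++
  [seq bump2 a | a <- comps M & ~~ nilp a].
Proof. by []. Qed.

Lemma nat_ind2 (P : nat -> Prop) :
  P 0%N -> P 1%N -> (forall n, P n -> P n.+1 -> P n.+2) -> forall n, P n.
Proof.
move=> P0 P1 PS n; suff [] : P n /\ P n.+1 by [].
by elim: n => // n [Pn Pn1]; split=> //; apply: PS.
Qed.

Lemma mem_comps M a : (a \in comps M) = all (ltn 0) a && (sumn a == M).
Proof.
elim/nat_ind2: M a => [||M IH0 IH1] a.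
- by rewrite inE; case: a => [|[|r] a] //=; rewrite andbF.
- rewrite inE; case: a => [|[|[|r]] [|[|s] a]] //=; rewrite ?andbF //.
rewrite compsSS !mem_cat.
case: a => [|r a].
  by apply/or3P; case=> /mapP[[|s b]] //; rewrite mem_filter.
have mem_cons s (L : seq (seq nat)) :
    (r :: a \in [seq s :: b | b <- L]) = (r == s) && (a \in L).
  apply/mapP/andP => [[b bL [-> ->]]|[/eqP -> aL]]; first by rewrite eqxx.
  by exists a.
(* A letter [r > 2] is the shift of the letter [r - 2]; positivity of letters in [comps] excludes
   [r = 2]. *)
have -> : (r :: a \in [seq bump2 b | b <- comps M & ~~ nilp b]) =
    (2 < r)%N && (r - 2 :: a \in comps M)%N.
  apply/mapP/andP => [[[|s b]]|[r2 ha]]; rewrite ?mem_filter //=.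
    move=> bM [-> ->]; rewrite !subSS subn0; rewrite IH0 in bM *.
    by split=> //; case: s bM.
  by exists (r - 2 :: a)%N; rewrite ?mem_filter //=; congr cons; lia.
rewrite !mem_cons !IH0 IH1 /=.
case: (all _ a); rewrite ?andbF //=; lia.
Qed.

Lemma comps_uniq M : uniq (comps M).
Proof.
elim/nat_ind2: M => // M IH0 IH1; rewrite compsSS !cat_uniq.
have cons_inj r : injective (cons r : seq nat -> seq nat) by move=> b c [].
rewrite !(map_inj_uniq (cons_inj _)) IH0 IH1.
rewrite map_inj_in_uniq ?filter_uniq //=; last first.
  by move=> [|r a] [|s b]; rewrite !mem_filter //= => _ _ [-> ->].
rewrite andbT -all_predC -[X in _ && X]all_predC; apply/andP; split.
  apply/allP => b /=; rewrite mem_cat.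
  move=> /orP[]/mapP[c hc ->]; apply/mapP => -[d _] //.
  case: c hc => [|r c]; rewrite mem_filter // mem_comps /=;
    by case=> _ /and3P[]; case: r.
apply/allP => b /= /mapP[c hc ->]; apply/mapP => -[d _].
case: c hc => [|r c]; rewrite mem_filter // mem_comps /=; by case: r.
Qed.

Lemma sum_compsSS (V : zmodType) (f : seq nat -> V) M :
  \sum_(a <- comps M.+2) f a =
    \sum_(a <- comps M.+1) f (1%N :: a) + \sum_(a <- comps M) f (2%N :: a)
    + \sum_(a <- comps M | ~~ nilp a) f (bump2 a).
Proof. by rewrite compsSS !big_cat !big_map big_filter /= addrA. Qed.

(** * Weights of compositions *)

Definition evens (a : seq nat) := count (fun r => ~~ odd r) a.
(** The total of the $q$'s: [r.-1./2] is $q$ both for $r = 2q+1$ and for $r = 2q+2$. *)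
Definition pairs (a : seq nat) := sumn [seq r.-1./2 | r <- a].
Definition odds (a : seq nat) := count odd a.

Lemma sumn_stat a : all (ltn 0) a ->
  (sumn a = odds a + 2 * (pairs a + evens a))%N.
Proof.
rewrite /odds /pairs /evens; elim: a => //= r a IH /andP[r0 /IH ->]; lia.
Qed.

Lemma size_stat (a : seq nat) : (size a = odds a + evens a)%N.
Proof. by rewrite /odds /evens -(count_predC odd). Qed.

(* The boolean factor discards the junk value 'C(_, 0) = 1 of the truncated
   difference when pairs a + evens a > n. *)
Definition weight (c d : {poly rat}) (n : nat) (a : seq nat) : {poly rat} :=
  ((pairs a + evens a <= n)%N * 'C(odds a, n - (pairs a + evens a)))%:R
    * c ^+ pairs a * d ^+ evens a.

(** With $k$ = [pairs a + evens a], the bound gives [odds a < n - k], so the binomial vanishes: the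
    power of $B$ would be negative. *)
Lemma weight_large c d n a :
  all (ltn 0) a -> (sumn a < n)%N -> weight c d n a = 0.
Proof.
move=> a0; rewrite (sumn_stat _ a0) => lt_n; rewrite /weight bin_small; last lia.
by rewrite muln0 !mul0r.
Qed.

(** Multiplication by $A + B$, the factor of the letter 1, is Pascal's rule. *)
Lemma weight1S c d n a :
  weight c d n.+1 (1%N :: a) = weight c d n.+1 a + weight c d n a.
Proof.
rewrite /weight /pairs /evens /odds /= !add0n -/(odds a) -/(evens a) -/(pairs a).
rewrite -!mulrDl -natrD; congr (_%:R * _ * _).
set k := (pairs a + evens a)%N.
case: (ltngtP k n.+1) => [lt_kn|lt_nk|->].
- have le_kn : (k <= n)%N by []. rewrite le_kn subSn // !mul1n add1n binS; lia.
- by rewrite (_ : (k <= n)%N = false) //; lia.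
(* At $k = n+1$ both outer binomials are 1 by [bin0], and the boolean kills the last summand. *)
- by rewrite subnn ltnn !bin0.
Qed.

Lemma weight10 c d a : weight c d 0 (1%N :: a) = weight c d 0 a.
Proof.
rewrite /weight /pairs /evens /odds /= !add0n -/(evens a) -/(pairs a).
by rewrite !sub0n !bin0.
Qed.

Lemma weight2S c d n a : weight c d n.+1 (2%N :: a) = d * weight c d n a.
Proof.
rewrite /weight /pairs /evens /odds /= !add0n -/(odds a) -/(evens a) -/(pairs a).
by rewrite addnCA !add1n ltnS subSS [d ^+ _.+1]exprS mulrCA.
Qed.

Lemma weight20 c d a : weight c d 0 (2%N :: a) = 0.
Proof. by rewrite /weight /= addnCA add1n ltn0 mul0n !mul0r. Qed.

Lemma weight_bump2S c d n a : all (ltn 0) a -> ~~ nilp a ->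
  weight c d n.+1 (bump2 a) = c * weight c d n a.
Proof.
case: a => //= -[|r] a //= _ _; rewrite /weight /pairs /evens /odds /= !negbK.
by rewrite !addSn ltnS subSS [c ^+ _.+1]exprS mulrCA !mulrA.
Qed.

Lemma weight_bump20 c d a : all (ltn 0) a -> ~~ nilp a ->
  weight c d 0 (bump2 a) = 0.
Proof.
case: a => //= -[|r] a //= _ _.
by rewrite /weight /pairs /= !addSn mul0n !mul0r.
Qed.

(** * The coefficients of $G$ and their recursion *)

Definition zprod (p : nat) (a : seq nat) : ht := \prod_(r <- a) z (r * p).

Lemma zprod_cons p r a : zprod p (r :: a) = z (r * p) * zprod p a.
Proof. by rewrite /zprod big_cons. Qed.

Lemma zprod_bump2 p a : (0 < p)%N -> all (ltn 0) a -> ~~ nilp a ->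
  zprod p (bump2 a) = x ^+ (p + p) * zprod p a.
Proof.
move=> p0; case: a => //= r a /andP[r0 _] _.
rewrite !zprod_cons /z !mulrA -exprD; congr (x ^+ _ * y * _); nia.
Qed.

(** The coefficient of $A^n B^{M-n}$ in $G$. *)
Definition compsum (c d : {poly rat}) (p n M : nat)  : ht :=
  \sum_(a <- comps M) weight c d n a *: zprod p a.

Lemma comps_pos M a : a \in comps M -> all (ltn 0) a.
Proof. by rewrite mem_comps => /andP[]. Qed.

Lemma compsum_large c d p n M : (M < n)%N -> compsum c d p n M = 0.
Proof.
move=> ltMn; rewrite /compsum big_seq big1 // => a.
rewrite mem_comps => /andP[a0 /eqP sa].
by rewrite weight_large ?scale0r ?sa.
Qed.

Lemma compsum00 c d p : compsum c d p 0 0 = 1.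
Proof.
by rewrite /compsum /= big_seq1 /weight /zprod big_nil /= !expr0 !mulr1 scale1r.
Qed.

(** Every letter other than 1 carries a factor $A$, so at $A^0$ only the first letter 1 survives. *)
Lemma compsum0S c d p M : compsum c d p 0 M.+1 = z p * compsum c d p 0 M.
Proof.
rewrite /compsum mulr_sumr; case: M => [|M].
  by rewrite !big_seq1 zprod_cons mul1n weight10 htAr.
rewrite sum_compsSS [X in _ + X + _]big1 => [|a _]; last first.
  by rewrite weight20 scale0r.
rewrite [X in _ + X]big_seq_cond [X in _ + X]big1 => [|a /andP[/comps_pos a0 na]].
  rewrite !addr0; apply: eq_bigr => a _.
  by rewrite weight10 zprod_cons mul1n htAr.
by rewrite weight_bump20 ?scale0r.
Qed.

(** The coefficient of $A^{n+1} B^{M+1-n}$ in the equation for $G$, with one term per kind of first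
    letter. The indicator of $M = 0$ records the $-1$ in $G - 1$. *)
Lemma compsumSS c d p n M : (0 < p)%N ->
  compsum c d p n.+1 M.+2 =
    z p * (compsum c d p n.+1 M.+1 + compsum c d p n M.+1)
    + d *: (z (p + p) * compsum c d p n M)
    + ((1 - (M == 0%N)%:R) * c) *: (x ^+ (p + p) * compsum c d p n M).
Proof.
move=> p0; rewrite {1}/compsum sum_compsSS.
apply: (f_equal2 +%R); first apply: (f_equal2 +%R).
- rewrite /compsum -big_split mulr_sumr; apply: eq_bigr => a _.
  by rewrite weight1S zprod_cons mul1n scalerDl mulrDr !htAr.
- rewrite /compsum mulr_sumr scaler_sumr; apply: eq_bigr => a _.
  by rewrite weight2S zprod_cons mul2n -addnn !htAr scalerA.
(* [comps 0] holds only the empty composition, which the filter removes; for $M > 0$ the filter is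
   vacuous. *)
case: M => [|M]; first by rewrite subrr mul0r scale0r big_cons big_nil.
rewrite subr0 mul1r /compsum mulr_sumr scaler_sumr big_seq_cond [RHS]big_seq.
apply: eq_big => a.
  by rewrite mem_comps; case: a => [|r a] /=; rewrite ?andbT.
move=> /andP[/comps_pos a0 na].
rewrite (zprod_bump2 _ _ p0 a0 na) htAr.
by rewrite (weight_bump2S _ _ _ _ a0 na) scalerA.
Qed.

Lemma compsumS1 c d p n : compsum c d p n.+1 1 = z p * compsum c d p n 0.
Proof.
rewrite /compsum !big_seq1 zprod_cons mul1n weight1S htAr.
by rewrite (@weight_large c d n.+1 [::]) // add0r.
Qed.

(** * Products of powers of $z_p$ *)

Lemma stuffle0s b : stuffle [::] b = \prod_(l <- b) z l.
Proof. by []. Qed.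

Lemma stuffles0 a : stuffle a [::] = \prod_(l <- a) z l.
Proof. by case: a => [|k a] /=. Qed.

(** The recursion is symmetric up to exchanging its first two terms. Hence peeling letters off the
    left operand also serves for the right one. *)
Lemma stuffleC a b : stuffle a b = stuffle b a.
Proof.
elim: a b => [|k a IHa] b; first by rewrite stuffle0s stuffles0.
elim: b => [|l b IHb]; first by rewrite stuffle0s stuffles0.
rewrite (stuffle_cons k) (stuffle_cons l) IHb (IHa (l :: b)) (IHa b).
by rewrite (addrC (z k * _)) (addnC k) (mulrC (nilp a)%:R).
Qed.

(** Both sides obey one recursion: [compsumSS] matches [stuffle_cons] with all letters equal to
    $p$. *)
Lemma stuffle_nseq p n v : (0 < p)%N ->
  stuffle (nseq n p) (nseq v p) =
    compsum (t ^+ 2 - t) (1 - 2%:R * t) p n (n + v).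
Proof.
move=> p0; have prodz k : \prod_(l <- nseq k p) z l = z p ^+ k.
  by rewrite big_nseq -Monoid.iteropE.
elim: n v => [|n IHn] v.
  rewrite stuffle0s prodz add0n.
  elim: v => [|v IHv]; first by rewrite compsum00.
  by rewrite compsum0S -IHv [z p ^+ _.+1]exprS.
elim: v => [|v IHv].
  rewrite stuffles0 prodz addn0; have := IHn 0%N; rewrite stuffles0 prodz addn0.
  rewrite [z p ^+ _.+1]exprS => ->; case: n {IHn} => [|n]; first by rewrite compsumS1.
  (* Here $v = 0$, and the coefficients with a negative power of $B$ drop out. *)
  rewrite compsumSS // !(@compsum_large _ _ p n.+1 n) ?(@compsum_large _ _ _ n.+2) //.
  by rewrite !mulr0 !scaler0 !addr0 add0r.
have nseqS k : nseq k.+1 p = p :: nseq k p by [].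
rewrite !nseqS stuffle_cons -!nseqS IHv !IHn !addnS !addSn.
rewrite (compsumSS _ _ _ _ _ p0) (mulrDr (z p)).
(* $\delta(w_1)\delta(w_2)$ is the indicator of $n + v = 0$, the one in [compsumSS]. *)
rewrite -natrM mulnb /nilp !size_nseq addn_eq0.
move: (z p * compsum _ _ p n _) (z p * compsum _ _ p n.+1 _) => S0 S1.
by rewrite (addrC S1).
Qed.

(** * From compositions to the tuples of the statement *)

Lemma card_tnth (T : Type) (N : nat) (P : pred T) (a : N.-tuple T) :
  #|[set s | P (tnth a s)]| = count P a.
Proof. by rewrite -sum1_count big_tuple sum1dep_card. Qed.

Lemma sumn_tnth (N : nat) (a : N.-tuple nat) :
  (\sum_(s < N) tnth a s = sumn a)%N.
Proof. by rewrite sumnE big_tuple. Qed.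

(** Dividing by $p$ turns entries into letters, even multiples of $p$ into even letters. Conversely,
    [tuplesA_complete] supplies the bounded tuple. *)
Lemma tuplesAP p N M j (s : seq nat) : (0 < p)%N ->
  reflect (exists2 b, b \in tuplesA p N M j &
             s = [seq (i %/ p)%N | i <- map val b])
    [&& s \in comps M, size s == N & evens s == j].
Proof.
move=> p0; have sumM s' : sumn [seq (r * p)%N | r <- s'] = (sumn s' * p)%N.
  by elim: s' => //= r s' ->; rewrite mulnDl.
have mulK s' : [seq (i %/ p)%N | i <- [seq (r * p)%N | r <- s']] = s'.
  by rewrite -map_comp -[RHS]map_id; apply: eq_map => r /=; rewrite mulnK.
have evensM s' :
    count (fun i => 2 * p %| i)%N [seq (r * p)%N | r <- s'] = evens s'.
  rewrite count_map; apply: eq_count => r /=.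
  by rewrite dvdn_pmul2r // dvdn2.
apply: (iffP and3P) => [[]|[b]].
  rewrite mem_comps => /andP[s0 /eqP sM] /eqP sN /eqP sj; subst N.
  have [||| b bA e] :=
    @tuplesA_complete p (size s) M j (map_tuple (muln^~ p) (in_tuple s)).
  - move=> i; rewrite tnth_map muln_gt0 p0 dvdn_mull // !andbT.
    by apply: (allP s0); apply: mem_tnth.
  - by rewrite sumn_tnth /= sumM sM.
  - by rewrite (card_tnth _ _ (fun i => 2 * p %| i)%N) /= evensM.
  by exists b; rewrite // e /= mulK.
rewrite inE => /and3P[/forallP b0 /eqP bM /eqP bj] ->.
set s1 := map val b; have {b0} s10 : all (fun i => (0 < i) && (p %| i))%N s1.
  by rewrite all_map; apply/all_tnthP.
have {bM} s1M : sumn s1 = (M * p)%N.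
  by rewrite -bM sumnE big_map big_tuple.
have {bj} s1j : count (fun i => 2 * p %| i)%N s1 = j.
  by rewrite -bj count_map -card_tnth.
have e : s1 = [seq (r * p)%N | r <- [seq (i %/ p)%N | i <- s1]].
  rewrite -map_comp -[LHS]map_id; apply/eq_in_map => i /(allP s10) /andP[_ ?] /=.
  by rewrite divnK.
split.
- rewrite mem_comps -(eqn_pmul2r p0) -sumM -e s1M eqxx andbT all_map.
  by apply: sub_all s10 => i /= /andP[i0 /dvdn_leq]; rewrite divn_gt0 //; apply.
- by rewrite !size_map size_tuple.
- by rewrite -evensM -e s1j.
Qed.

Lemma sum_tuplesA p N M j : (0 < p)%N ->
  \sum_(a in tuplesA p N M j) \prod_(s < N) z (tnth a s) =
  \sum_(a <- comps M | (size a == N) && (evens a == j)) zprod p a.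
Proof.
move=> p0.
pose f (b : N.-tuple 'I_(M * p).+1) := [seq (i %/ p)%N | i <- map val b].
have dvd_b (b : N.-tuple 'I_(M * p).+1) : b \in tuplesA p N M j ->
    map val b = [seq (r * p)%N | r <- f b].
  rewrite inE => /and3P[/forallP b0 _ _]; rewrite /f -!map_comp.
  apply/eq_in_map => i /tnthP[s ->] /=; rewrite divnK //.
  by have /andP[] := b0 s.
rewrite -[RHS]big_filter.
(* Division by $p$ is injective on [tuplesA], whose entries are multiples of $p$, so its image lists
   each composition once. *)
rewrite [RHS](perm_big [seq f b | b <- enum (tuplesA p N M j)]) /=; last first.
  rewrite perm_sym; apply: uniq_perm; last 1 first.
  - move=> s; rewrite mem_filter andbC; apply/mapP/(tuplesAP p N M j s p0).
      by case=> b; rewrite mem_enum; exists b.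
    by case=> b bA e; exists b; rewrite // mem_enum.
  - rewrite map_inj_in_uniq ?enum_uniq // => b b'; rewrite !mem_enum.
    move=> /dvd_b e /dvd_b e' ff'; apply/val_inj/(inj_map val_inj).
    by rewrite e e' ff'.
  - exact/filter_uniq/comps_uniq.
rewrite big_map big_enum; apply: eq_bigr => b /dvd_b e.
by rewrite /zprod -(big_map (muln^~ p) xpredT z) -e big_map big_tuple.
Qed.

(** At most one triple $(k,i,j)$ contributes: $j$ must be [evens a], and comparing the size of [a]
    with its sum then forces $i$ = [pairs a]. *)
Lemma weight_scale (V : lmodType {poly rat}) c d n v (a : seq nat) (w : V) :
  a \in comps (n + v) ->
  weight c d n a *: w =
    \sum_(0 <= k < (minn n v).+1)
      \sum_(i < k.+1) \sum_(j < k.+1 | (i + j == k)%N)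
      if (size a == n + v - i - k)%N && (evens a == j)
      then ('C(n + v - 2 * k, n - k)%:R * c ^+ i * d ^+ j) *: w else 0.
Proof.
rewrite mem_comps => /andP[a0 /eqP]; rewrite (sumn_stat _ a0) => aM.
have sa := size_stat a; rewrite big_mkord.
(* As $i + k \le 2k \le n + v$, the difference [n + v - i - k] does not truncate. *)
have stat k i j : (k <= minn n v)%N -> (i + j = k)%N ->
    (size a == n + v - i - k)%N && (evens a == j) ->
    [/\ i = pairs a, j = evens a & k = (pairs a + evens a)%N].
  by move=> le_k ijk /andP[/eqP sz /eqP ej]; split; lia.
have [le_k|gt_k] := leqP (pairs a + evens a) (minn n v); last first.
  rewrite !big1 => [|k _]; last first.
    rewrite big1 // => i _; rewrite big1 // => j /eqP ijk.
    case: ifP => // /(stat k i j _ ijk)[]; first by rewrite -ltnS.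
    by move=> _ _ ek; exfalso; have := ltn_ord k; rewrite ltnS leqNgt ek gt_k.
  (* With $k$ = [pairs a + evens a], the weight vanishes by its boolean if $k > n$; otherwise $k >
     v$, and [odds a] $= n + v - 2k < n - k$ makes the binomial zero. *)
  rewrite /weight; case: leqP => [le_n|_]; last by rewrite mul0n !mul0r scale0r.
  by rewrite bin_small ?muln0 ?mul0r ?scale0r //; lia.
have lt_k : (pairs a + evens a < (minn n v).+1)%N by [].
rewrite (bigD1 (Ordinal lt_k)) //= [X in _ + X]big1 => [|k /eqP ne_k];
  last first.
  rewrite big1 // => i _; rewrite big1 // => j /eqP ijk.
  case: ifP => // /(stat k i j _ ijk)[]; first by rewrite -ltnS.
  by move=> _ _ ek; case: ne_k; apply: val_inj.
have lt_i : (pairs a < (pairs a + evens a).+1)%N by lia.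
rewrite addr0 (bigD1 (Ordinal lt_i)) //= [X in _ + X]big1 => [|i /eqP ne_i];
  last first.
  rewrite big1 // => j /eqP ijk.
  case: ifP => // /(stat _ i j le_k ijk)[ei _ _].
  by case: ne_i; apply: val_inj.
have lt_j : (evens a < (pairs a + evens a).+1)%N by lia.
rewrite addr0 (bigD1 (Ordinal lt_j)) //= [X in _ + X]big1 => [|j /andP[/eqP ijk /eqP ne_j]]; last first.
  case: ifP => // /(stat _ _ j le_k ijk)[_ ej _].
  by case: ne_j; apply: val_inj.
rewrite addr0 ifT; last lia.
have -> : (n + v - 2 * (pairs a + evens a) = odds a)%N by lia.
by rewrite /weight (leq_trans le_k (geq_minl _ _)) mul1n.
Qed.

(** [M] and [M'] are kept apart because the theorem spells the same number as [v + n - l] and as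
    [n + v - l]. *)
Lemma mul_stuffle_nseq p n v M M' (f : ht) :
  (0 < p)%N -> M = (n + v)%N -> M' = (n + v)%N ->
  f * stuffle (nseq n p) (nseq v p) =
    \sum_(0 <= k < (minn n v).+1)
      \sum_(i < k.+1) \sum_(j < k.+1 | (i + j == k)%N)
      \sum_(a in tuplesA p (M - i - k) M' j)
        ('C(M - 2 * k, n - k)%:R * (t ^+ 2 - t) ^+ i * (1 - 2%:R * t) ^+ j)
        *: (f * \prod_(s < M - i - k) z (tnth a s)).
Proof.
move=> p0 -> ->; rewrite stuffle_nseq // /compsum.
move: (t ^+ 2 - t) (1 - 2%:R * t) => c d.
rewrite big_seq; under eq_bigr => a aM do rewrite (weight_scale _ _ _ _ _ _ _ aM).
rewrite -big_seq exchange_big mulr_sumr; apply: eq_bigr => k _.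
rewrite exchange_big mulr_sumr; apply: eq_bigr => i _.
rewrite exchange_big mulr_sumr; apply: eq_bigr => j _.
rewrite -scaler_sumr -mulr_sumr sum_tuplesA // -htAr scaler_sumr.
by rewrite [in RHS]big_mkcond.
Qed.

(** * Peeling off the letters before $z_u$ *)

Lemma ht_mulrDZ (c d : {poly rat}) (f g1 g2 g3 : ht) :
  f * (g1 + c *: g2 + d *: g3) = f * g1 + c *: (f * g2) + d *: (f * g3).
Proof. by rewrite 2!mulrDr 2!htAr. Qed.

(** The prefix produced when $l$ letters $z_p$ and $z_u$ have been used: $z_u$ follows the $l$-th
    $z_p$ or merges with it. The deltas detect that both remaining words are empty. *)
Definition unrolled (p u n v l : nat) : ht :=
  z p ^+ l * z u
  + (1 - 2%:R * t) *: (z p ^+ (l - 1) * z (u + p))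
  + ((1 - delta v 0 * delta n l) * (t ^+ 2 - t))
      *: (z p ^+ (l - 1) * x ^+ (u + p)).

Lemma unrolledS p u n v l : (0 < l)%N ->
  unrolled p u n.+1 v l.+1 = z p * unrolled p u n v l.
Proof.
case: l => // l _; rewrite /unrolled /delta eqSS !subSS !subn0.
move: (_ * (_ - t)) (1 - _ * t) (z (u + p)) (x ^+ _) (z u) => c d zup xup zu.
rewrite !(exprS (z p)); move: (z p) (z p ^+ l) => zp zpl.
by rewrite ht_mulrDZ !(mulrA zp).
Qed.

(** By induction on $n$: taking $z_p$ first shifts $l$ by one, and taking $z_u$ first gives the term
    outside the sum. *)
Lemma stuffle_nseq_cons p u n v :
  stuffle (nseq n p) (u :: nseq v p) =
    z u * stuffle (nseq n p) (nseq v p) +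
    \sum_(1 <= l < n.+1)
      unrolled p u n v l * stuffle (nseq (n - l) p) (nseq v p).
Proof.
elim: n => [|n IHn]; first by rewrite big_geq // addr0 !stuffle0s big_cons.
have nseqS k : nseq k.+1 p = p :: nseq k p by [].
rewrite nseqS stuffle_cons -nseqS IHn (mulrDr (z p)).
rewrite [in RHS]big_ltn // [in RHS]big_add1 subSS subn0.
rewrite [X in _ = _ + (_ + X)](_ : _ = z p * \sum_(1 <= l < n.+1)
      unrolled p u n v l * stuffle (nseq (n - l) p) (nseq v p)); last first.
  rewrite mulr_sumr; apply: eq_big_nat => l /andP[l0 _].
  by rewrite unrolledS // subSS mulrA.
set rest := \sum_(_ <= _ < _) _.
rewrite /unrolled /nilp !size_nseq subnn expr0 expr1 !mul1r /delta eqSS.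
rewrite (addnC p) (mulrC (n == 0)%N%:R).
move: (_ * (_ - t)) (1 - _ * t) (stuffle _ _) (stuffle (nseq n p) _) => c d S1 S0.
rewrite !mulrDl -!scalerAl mulrA.
(* The summand $l = 1$ collects $z_p z_u$ from the induction hypothesis and the two merged terms. *)
by rewrite [LHS](ACl (3 * ((1 * 4 * 5) * 2))%AC).
Qed.

(** The remaining powers are swapped so that [mul_stuffle_nseq] gives a binomial with lower index
    [v - k]. *)
Lemma mul_stuffle_nseq_cons p u n v (f : ht) :
  f * stuffle (nseq n p) (u :: nseq v p) =
    f * (z u * stuffle (nseq n p) (nseq v p)) +
    \sum_(1 <= l < n.+1)
      f * unrolled p u n v l * stuffle (nseq v p) (nseq (n - l) p).
Proof.
rewrite stuffle_nseq_cons mulrDr mulr_sumr; congr (_ + _).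
by apply: eq_bigr => l _; rewrite mulrA (stuffleC (nseq v p)).
Qed.

Theorem theorem1 (m u p n v : nat) :
  (2 <= m)%N -> (2 <= u)%N -> (1 <= p)%N ->
  tstuffle (z m * z p ^+ n) (z u * z p ^+ v) =
    \sum_(1 <= l < n.+1) \sum_(0 <= k < (minn v (n - l)).+1)
      \sum_(i < k.+1) \sum_(j < k.+1 | (i + j == k)%N)
      \sum_(a in tuplesA p (v + n - l - i - k) (n + v - l) j)
        ('C(v + n - l - 2 * k, v - k)%:R
           * (t ^+ 2 - t) ^+ i * (1 - 2%:R * t) ^+ j)
        *: (z m
            * (z p ^+ l * z u
               + (1 - 2%:R * t) *: (z p ^+ (l - 1) * z (u + p))
               + ((1 - delta v 0 * delta n l) * (t ^+ 2 - t))
                   *: (z p ^+ (l - 1) * x ^+ (u + p)))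
            * \prod_(s < v + n - l - i - k) z (tnth a s))
    + \sum_(1 <= l < v.+1) \sum_(0 <= k < (minn n (v - l)).+1)
        \sum_(i < k.+1) \sum_(j < k.+1 | (i + j == k)%N)
        \sum_(a in tuplesA p (v + n - l - i - k) (n + v - l) j)
          ('C(v + n - l - 2 * k, n - k)%:R
             * (t ^+ 2 - t) ^+ i * (1 - 2%:R * t) ^+ j)
          *: (z u
              * (z p ^+ l * z m
                 + (1 - 2%:R * t) *: (z p ^+ (l - 1) * z (m + p))
                 + ((1 - delta n 0 * delta v l) * (t ^+ 2 - t))
                     *: (z p ^+ (l - 1) * x ^+ (m + p)))
              * \prod_(s < v + n - l - i - k) z (tnth a s))
    + \sum_(0 <= k < (minn n v).+1)
        \sum_(i < k.+1) \sum_(j < k.+1 | (i + j == k)%N)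
        \sum_(a in tuplesA p (v + n - i - k) (n + v) j)
          ('C(v + n - 2 * k, n - k)%:R
             * (t ^+ 2 - t) ^+ i * (1 - 2%:R * t) ^+ j)
          *: ((z m * z u + z u * z m
               + (1 - 2%:R * t) *: z (m + u)
               + ((1 - delta n 0 * delta v 0) * (t ^+ 2 - t))
                   *: x ^+ (m + u))
              * \prod_(s < v + n - i - k) z (tnth a s)).
Proof.
move=> m2 u2 p0; have prodz k : \prod_(l <- nseq k p) z l = z p ^+ k.
  by rewrite big_nseq -Monoid.iteropE.
have pos k r : (2 <= r)%N -> all (ltn 0) (r :: nseq k p).
  by case: r => //= r _; rewrite all_nseq; apply/orP; right.
have encz k r : z r * z p ^+ k = << encode (r :: nseq k p) >>.
  by rewrite -prod_zE big_cons prodz.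
rewrite !encz (tstuffle_encode (pos n m m2) (pos v u u2)).
(* One step of the recursion puts $z_m$ or $z_u$ in front, or merges them; in the first two cases
   peeling then reaches the other letter. *)
rewrite stuffle_cons (stuffleC (m :: _)) !mul_stuffle_nseq_cons.
rewrite (stuffleC (nseq v p) (nseq n p)).
(* The two peeling sums come first; the four terms containing the product of $z_p^n$ and $z_p^v$
   form the third sum. *)
rewrite [LHS](AC (2 * 2 * 1 * 1)%AC ((2 * 4) * (1 * 3 * 5 * 6))%AC).
apply: (f_equal2 +%R); first apply: (f_equal2 +%R).
- apply: eq_big_nat => l /andP[l0 ln].
  by apply: mul_stuffle_nseq => //; lia.
- apply: eq_big_nat => l /andP[l0 lv].
  by apply: mul_stuffle_nseq => //; lia.
rewrite -(@mul_stuffle_nseq p n v) //; last by rewrite addnC.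
rewrite /nilp !size_nseq /delta.
move: (_ * (_ - t)) (1 - _ * t) (stuffle _ _) => c d S.
move: (z (m + u)) (x ^+ _) (z m) (z u) => zmu xmu zm zu.
by rewrite !mulrDl -!scalerAl !mulrA.
Qed.
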